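(* Let $Z$ be a separable metric space and let $\mathcal{R}$ be a binary relation on the set $\Delta(Z)$ of Borel probability measures on $Z$. Define $$\mathscr{U}_0:=\big\{\{u\in\mathrm{C}_b(Z):\ \mathbf{E}_p[u]<\mathbf{E}_q[u]\}:\ p,q\in\Delta(Z)\big\}.$$ Then $\mathcal{R}$ is reflexive, transitive, and satisfies the independence axiom if and only if there exists a nonempty family $\mathscr{U}\subseteq\mathcal{P}(\mathrm{C}_b(Z))$ of nonempty subsets such that: (a) for all $p,q\in\Delta(Z)$, $$(p,q)\in\mathcal{R}\iff \forall U\in\mathscr{U},\ \exists u\in U,\ \mathbf{E}_p[u]\ge\mathbf{E}_q[u];$$ (b) for all $U_1,U_2,V\in\mathscr{U}_0$ with $V\subseteq U_1\cup U_2$: if $\mathcal{P}(U_1)\cap\mathscr{U}=\emptyset$ and $\mathcal{P}(U_2)\cap\mathscr{U}=\emptyset$, then $\mathcal{P}(V)\cap\mathscr{U}=\emptyset$.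
   Context: $\mathrm{C}_b(Z)$ is the space of bounded continuous real functions on $Z$, $\mathcal{P}(S)$ is the power set of $S$, and $\mathbf{E}_r[u]:=\int u\,\mathrm{d}r$ for $r\in\Delta(Z)$ and $u\in\mathrm{C}_b(Z)$. A binary relation on a set $S$ is a subset $\mathcal{R}\subseteq S^2$. If $S$ is a convex subset of a vector space, $\mathcal{R}$ satisfies the independence axiom if for all $a,b,c\in S$ and all $\alpha\in(0,1)$, $$(a,b)\in\mathcal{R}\iff(\alpha a+(1-\alpha)c,\ \alpha b+(1-\alpha)c)\in\mathcal{R}.$$ Here $S=\Delta(Z)$, viewed as a convex subset of the space of finite signed Borel measures on $Z$. *)

(* Defs.v *)
From HB Require Import structures.
From mathcomp Require Import all_boot all_order all_algebra.
From mathcomp Require Import all_classical all_reals all_analysis.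

Set Implicit Arguments.
Unset Strict Implicit.
Unset Printing Implicit Defensive.

Import Order.TTheory GRing.Theory Num.Theory.
Import numFieldNormedType.Exports.

Local Open Scope classical_set_scope.
Local Open Scope ring_scope.

Definition separable_space (T : topologicalType) : Prop :=
  exists D : set T, countable D /\ dense D.

Lemma probability_ext d (T : measurableType d) (R : realType)
  (P Q : probability T R) : (P : set T -> \bar R) = Q -> P = Q.
Proof.
case: P => P [[p1 p2] [p3] [p4] [p5] [p6] [p7] [p8]].
case: Q => Q [[q1 q2] [q3] [q4] [q5] [q6] [q7] [q8]] /= PQ.
subst Q; f_equal.
by rewrite (Prop_irrelevance q1 p1) (Prop_irrelevance q2 p2)
  (Prop_irrelevance q3 p3) (Prop_irrelevance q4 p4) (Prop_irrelevance q5 p5)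
  (Prop_irrelevance q6 p6) (Prop_irrelevance q7 p7) (Prop_irrelevance q8 p8).
Qed.

(* Every measurableType is pointed, whereas a metric space may be empty.  The
   point is recovered from a proof of [inhabited Z], hence is not extra data. *)
Definition inhabited_copy (Z : choiceType) (ne : inhabited Z) : Type := Z.

HB.instance Definition _ (Z : choiceType) (ne : inhabited Z) :=
  Choice.copy (inhabited_copy ne) Z.
HB.instance Definition _ (Z : choiceType) (ne : inhabited Z) :=
  isPointed.Build (inhabited_copy ne) (inhabited_witness ne).

Notation borel ne :=
  (@g_sigma_algebraType (inhabited_copy ne) (@open _)).

Section Delta.
Context (R : realType) (Z : topologicalType).

(* A [probability] is a function on all subsets, unconstrained outside of the
   sigma-algebra.  [Delta_off] fixes its values there, so that two elements are
   equal as soon as they agree on the Borel sets ([Delta_ext] below).  There is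
   no probability measure on an empty space, whence [Delta_inhabited]. *)
Record Delta := MkDelta {
  Delta_inhabited : inhabited Z ;
  Delta_prob :> probability (borel Delta_inhabited) R ;
  Delta_off : forall A : set Z, ~ <<s @open Z >> A -> Delta_prob A = 0%E }.

Lemma Delta_ext (p q : Delta) :
  (forall A : set Z, <<s @open Z >> A -> p A = q A) -> p = q.
Proof.
move=> pq.
have {pq} : (p : set Z -> \bar R) = q.
  apply/funext => A; have [/pq//|nA] := pselect (<<s @open Z >> A).
  by rewrite !Delta_off.
case: p => ne [p pP] po; case: q => ne' [q qP] qo /= pq.
move: p pP po q qP qo pq.
rewrite (Prop_irrelevance ne' ne) => p pP po q qP qo /= pq.
subst q.
have e : Probability.Pack pP = Probability.Pack qP by exact: probability_ext.
move: po qo; rewrite e => po qo; congr MkDelta; exact: Prop_irrelevance.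
Qed.

Section mix.
Variables (a : R) (a01 : 0 < a < 1) (p q : Delta).

Definition mix_fun (A : set (borel (Delta_inhabited p))) : \bar R :=
  (a%:E * p A + (1 - a)%:E * q A)%E.

Let a_ge0 : (0 <= a%:E :> \bar R)%E.
Proof. by rewrite lee_fin ltW//; case/andP: a01. Qed.

Let b_ge0 : (0 <= (1 - a)%:E :> \bar R)%E.
Proof. by rewrite lee_fin subr_ge0 ltW//; case/andP: a01. Qed.

Let mix0 : mix_fun set0 = 0%E.
Proof. by rewrite /mix_fun !measure0 !mule0 adde0. Qed.

Let mix_ge0 A : (0 <= mix_fun A)%E.
Proof. by rewrite /mix_fun adde_ge0// mule_ge0. Qed.

Let mix_sigma_additive : semi_sigma_additive mix_fun.
Proof.
move=> F mF tF mUF.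
have pF := @measure_semi_sigma_additive _ _ _ p F mF tF mUF.
have qF := @measure_semi_sigma_additive _ _ _ q F mF tF mUF.
rewrite (_ : (fun n => _) = (fun n =>
    a%:E * (\sum_(0 <= i < n) p (F i)) +
    (1 - a)%:E * (\sum_(0 <= i < n) q (F i)))%E); last first.
  apply/funext => n.
  by rewrite /mix_fun big_split/= !ge0_sume_distrr.
apply: cvgeD.
- by apply: ge0_adde_def; rewrite inE mule_ge0.
- exact: cvgeZl.
- exact: cvgeZl.
Qed.

HB.instance Definition _ := isMeasure.Build _ _ _ mix_fun
  mix0 mix_ge0 mix_sigma_additive.

Let mix_setT : mix_fun setT = 1%E.
Proof.
rewrite /mix_fun (probability_setT p) (probability_setT q) !mule1.
by rewrite -EFinD addrC subrK.
Qed.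

HB.instance Definition _ :=
  Measure_isProbability.Build _ _ _ mix_fun mix_setT.

Let mix_off (A : set Z) : ~ <<s @open Z >> A -> mix_fun A = 0%E.
Proof. by move=> nA; rewrite /mix_fun !Delta_off// !mule0 adde0. Qed.

Definition mix : Delta :=
  @MkDelta (Delta_inhabited p) mix_fun mix_off.

Lemma mixE (A : set Z) : mix A = (a%:E * p A + (1 - a)%:E * q A)%E.
Proof. by []. Qed.

End mix.

Definition independence (Rel : set (Delta * Delta)) : Prop :=
  forall (p q r : Delta) (a : R) (a01 : 0 < a < 1),
    Rel (p, q) <-> Rel (mix a01 p r, mix a01 q r).

Definition Cb : set (Z -> R) := [set u | continuous u /\ bounded_fun u].

Definition expect (r : Delta) (u : Z -> R) : R := \int[Delta_prob r]_z u z.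

Definition scrU0 : set (set (Z -> R)) :=
  [set U | exists p q : Delta, U = [set u | Cb u /\ expect p u < expect q u]].

End Delta.

Definition power (T : Type) (A : set T) : set (set T) :=
  [set B | B `<=` A].

(* Main.v *)
Require Import Defs.
From HB Require Import structures.
From mathcomp Require Import all_boot all_order all_algebra.
From mathcomp Require Import all_classical all_reals all_analysis.
From mathcomp Require Import measurable_realfun ring lra.
Import Order.TTheory GRing.Theory Num.Theory.
Import numFieldNormedType.Exports.
Local Open Scope classical_set_scope.
Local Open Scope ring_scope.

(** Write [D p q] for the set of bounded continuous [u] with
    [E_p u < E_q u] ([prefer p q] below).  Condition (a) says that [(p, q)] is
    in the relation exactly when no member of the family is contained in
    [D p q], so (b) says that the relation inherits coverings: if
    [D p q] is contained in the union of [D p1 q1] and [D p2 q2], and both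
    [(p1, q1)] and [(p2, q2)] are related, then so is [(p, q)].

    A relation with this property, represented by nonempty sets, is an
    independent preorder: [D p p] is empty, [D p r] is covered by [D p q] and
    [D q r], and mixing both measures with a third one does not change [D],
    as expectations are affine ([expect_mix]).

    Conversely, an independent preorder has the covering property
    ([rel_cover]), and it is then represented by the family of all [D p q] with
    [(p, q)] unrelated; the set of all bounded continuous functions is added so
    that the family is never empty.  For the covering property, consider the
    linear functionals [E_q - E_p], [E_q1 - E_p1] and [E_q2 - E_p2].  The
    inclusion says that the first is nonpositive wherever the other two are, so
    by Farkas' lemma ([farkas2]) it equals [a (E_q1 - E_p1) + b (E_q2 - E_p2)]
    with [a, b >= 0].  For only two constraints, Farkas' lemma is elementary
    linear algebra and holds on every vector space without topology.  Bounded
    continuous functions separate probability measures ([expect_inj]), so this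
    is an identity [q + a p1 + b p2 = p + a q1 + b q2] between measures, and
    independence and transitivity carry the relation along it. *)

Set Implicit Arguments.
Unset Strict Implicit.

(** * Farkas' lemma for two functionals *)

Section Farkas.
Context {R : realFieldType} {V : lmodType R}.
Implicit Types (W : set V) (f g h : V -> R).

Definition subspace_set W :=
  W 0 /\ forall a u v, W u -> W v -> W (a *: u + v).

Definition linear_on W f :=
  forall a u v, W u -> W v -> f (a *: u + v) = a * f u + f v.

Lemma linear_on0 W f : subspace_set W -> linear_on W f -> f 0 = 0.
Proof.
by move=> [W0 _] lf; have := lf 1 0 0 W0 W0; rewrite scaler0 addr0; lra.
Qed.

Lemma linear_onZ W f : subspace_set W -> linear_on W f ->
  forall a v, W v -> W (a *: v) /\ f (a *: v) = a * f v.
Proof.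
move=> sW lf a v Wv; have [W0 WD] := sW.
have := WD a v 0 Wv W0; have := lf a v 0 Wv W0.
by rewrite (linear_on0 sW lf) !addr0.
Qed.

Definition null_on W g := [set v | W v /\ g v = 0].

Lemma null_on_subspace W g : subspace_set W -> linear_on W g ->
  subspace_set (null_on W g).
Proof.
move=> sW lg; split; first by split; [case: sW|exact: (linear_on0 sW lg)].
move=> a u v [Wu gu] [Wv gv]; split; first by case: sW => _; apply.
by rewrite lg// gu gv mulr0 addr0.
Qed.

Lemma linear_onS W W' f : W' `<=` W -> linear_on W f -> linear_on W' f.
Proof. by move=> sub lf a u v /sub Wu /sub Wv; exact: lf. Qed.

Lemma null_or_unit W g : subspace_set W -> linear_on W g ->
  (forall v, W v -> g v = 0) \/ exists2 v, W v & g v = 1.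
Proof.
move=> sW lg; have [|/existsNP[v /not_implyP[Wv gv]]] :=
  pselect (forall v, W v -> g v = 0); first by left.
have [WZ gZ] := linear_onZ sW lg (g v)^-1 Wv.
by right; exists ((g v)^-1 *: v); rewrite // gZ mulVf//; exact/eqP.
Qed.

(** Every [v] is a multiple of [w] up to the vector [v - g v w], which lies in
    the kernel of [g]. *)
Lemma proportional W f g w : subspace_set W -> linear_on W f -> linear_on W g ->
  W w -> g w = 1 -> (forall v, null_on W g v -> f v = 0) ->
  forall v, W v -> f v = f w * g v.
Proof.
move=> sW lf lg Ww gw f0 v Wv.
have : null_on W g (- g v *: w + v).
  by split; [case: sW => _; apply|rewrite lg// gw; ring].
by move=> /f0; rewrite lf//; lra.
Qed.

(** A linear function that vanishes on the kernel of [g] is a multiple of [g];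
    evaluation at [- w] with [g w = 1] gives the sign. *)
Lemma farkas1 W f g : subspace_set W -> linear_on W f -> linear_on W g ->
  (forall v, W v -> g v <= 0 -> f v <= 0) ->
  exists2 a, 0 <= a & forall v, W v -> f v = a * g v.
Proof.
move=> sW lf lg fg.
have neg f' v : linear_on W f' -> W v -> W (-1 *: v) /\ f' (-1 *: v) = - f' v.
  by move=> /(linear_onZ sW) h /(h (-1)); rewrite mulN1r.
have f0 v : null_on W g v -> f v = 0.
  move=> [Wv gv]; have [Wn fn] := neg f v lf Wv; have [_ gn] := neg g v lg Wv.
  have := fg _ Wv; have := fg _ Wn; rewrite fn gn gv; lra.
have [g0|[w Ww gw]] := null_or_unit sW lg.
  by exists 0 => // v Wv; rewrite mul0r; apply: f0; split=> //; exact: g0.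
exists (f w); last exact: proportional.
have [Wn fn] := neg f w lf Ww; have [_ gn] := neg g w lg Ww.
by have := fg _ Wn; rewrite fn gn gw; lra.
Qed.

(** On the kernel of [g] the hypothesis has a single constraint, so there
    [f = b h] with [b >= 0] by [farkas1].  Hence [f - b h] is a multiple [a g] of
    [g] on all of [W], and the sign of [a] is read off at a vector [v] with
    [g v = -1] and [h v = 0].  There is such a vector unless [h] is itself a
    multiple of [g], which is treated apart. *)
Lemma farkas2 W f g h :
  subspace_set W -> linear_on W f -> linear_on W g -> linear_on W h ->
  (forall v, W v -> g v <= 0 -> h v <= 0 -> f v <= 0) ->
  exists a b, [/\ 0 <= a, 0 <= b & forall v, W v -> f v = a * g v + b * h v].
Proof.
move=> sW lf lg lh fgh.
have [g0|[w Ww gw]] := null_or_unit sW lg.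
  have [b b0 fb] : exists2 b, 0 <= b & forall v, W v -> f v = b * h v.
    by apply: farkas1 => // v Wv hv; apply: fgh => //; rewrite g0.
  by exists 0, b; split=> // v Wv; rewrite fb// mul0r add0r.
have sN := null_on_subspace sW lg.
have NW : null_on W g `<=` W by move=> ? [].
have [lfN lhN] := (linear_onS NW lf, linear_onS NW lh).
have [h0|[z [Wz gz] hz]] := null_or_unit sN lhN.
  have hE := proportional sW lh lg Ww gw h0.
  (* Here [h = h w * g]: if [h w >= 0] the constraint on [h] is redundant;
     otherwise [g] and [h] have opposite signs and either can carry [f]. *)
  have [hw0|hw0] := leP 0 (h w).
    have [a a0 fa] : exists2 a, 0 <= a & forall v, W v -> f v = a * g v.
      apply: farkas1 => // v Wv gv; apply: fgh => //.
      by rewrite hE// mulr_ge0_le0.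
    by exists a, 0; split=> // v Wv; rewrite fa// mul0r addr0.
  have fE : forall v, W v -> f v = f w * g v.
    apply: proportional => // v Nv.
    have hv := h0 v Nv; case: Nv => Wv gv.
    have [Wn fn] := linear_onZ sW lf (-1) Wv.
    have [_ gn] := linear_onZ sW lg (-1) Wv.
    have [_ hn] := linear_onZ sW lh (-1) Wv.
    have := fgh _ Wv; have := fgh _ Wn; rewrite fn gn hn gv hv; lra.
  have [fw0|fw0] := leP 0 (f w).
    by exists (f w), 0; split=> // v Wv; rewrite fE// mul0r addr0.
  exists 0, (f w / h w); split => //; first by rewrite nmulr_rge0 ?invr_le0// ltW.
  by move=> v Wv; rewrite fE// (hE v)//; field; rewrite lt_eqF.
have [b b0 fb] : exists2 b, 0 <= b & forall v, null_on W g v -> f v = b * h v.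
  by apply: farkas1 => // v [Wv gv] hv; apply: fgh; rewrite ?gv.
have fE : forall v, W v -> f v - b * h v = (f w - b * h w) * g v.
  apply: (proportional (f := fun v => f v - b * h v)) => //.
    by move=> a u v Wu Wv; rewrite lf// lh//; ring.
  by move=> v Nv; rewrite fb// subrr.
exists (f w - b * h w), b; split=> //; last by move=> v Wv; have := fE v Wv; lra.
have [WN fN] := linear_onZ sW lf (-1) Ww.
have [_ gN] := linear_onZ sW lg (-1) Ww.
have [_ hN] := linear_onZ sW lh (-1) Ww.
(* [h w z - w] is the vector where [g] is [-1] and [h] vanishes. *)
have Wt : W (h w *: z + -1 *: w) by case: sW => _; apply.
have fz : f z = b by rewrite fb// hz mulr1.
have : f (h w *: z + -1 *: w) <= 0.
  by apply: fgh => //; rewrite ?lg ?lh// ?gN ?hN ?gz ?gw ?hz; lra.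
by rewrite lf// fN fz; lra.
Qed.

End Farkas.

(** * Expectations of bounded continuous functions *)

Section Expectation.
Context {R : realType} {Z : topologicalType}.

Lemma Cb_subspace : subspace_set (@Cb R Z).
Proof.
split.
  split; first by move=> x; exact: cst_continuous.
  by exists 0; split=> // M M0 x _; rewrite /= normr0 ltW.
move=> a u v [cu [M [Mr bu]]] [cv [N [Nr bv]]]; split.
  by move=> x; apply: (@cvgD _ R^o); [apply: cvgZr; exact: cu|exact: cv].
exists (`|a| * (`|M| + 1) + (`|N| + 1)); split => // K hK x _ /=.
apply: le_trans (ltW hK); apply: le_trans (ler_normD _ _) _; rewrite lerD//.
  by rewrite normrM ler_wpM2l// bu// ltr_pwDr// ler_norm.
by apply: bv => //; rewrite ltr_pwDr// ler_norm.
Qed.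

Section Integral.
Variable ne : inhabited Z.

Lemma open_borel (A : set Z) : open A -> measurable (A : set (borel ne)).
Proof. by move=> oA; exact: sub_sigma_algebra. Qed.

Lemma continuous_borel (u : Z -> R) : continuous u ->
  measurable_fun [set: borel ne] u.
Proof.
move=> /continuousP cu; apply: (measurability _ (RGenOpens.measurableE R)).
move=> _ [_ [a [b ->] <-]]; rewrite setTI; apply: open_borel.
exact/cu/interval_open.
Qed.

Lemma Cb_integrable (P : probability (borel ne) R) (u : Z -> R) :
  Cb u -> P.-integrable [set: borel ne] (EFin \o u).
Proof.
move=> [cu bu]; apply: measurable_bounded_integrable => //.
- by rewrite (le_lt_trans (probability_le1 _ _))// ltry.
- exact: continuous_borel.
Qed.

End Integral.

Lemma expect_linear (p : Delta R Z) : linear_on (@Cb R Z) (expect p).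
Proof.
move=> a u v Cu Cv; rewrite /expect.
have iu := Cb_integrable (Delta_prob p) Cu.
have iv := Cb_integrable (Delta_prob p) Cv.
rewrite -RintegralZl// -RintegralD//.
apply: (Cb_integrable (Delta_prob p) (u := a *: u)).
have [C0 CD] := Cb_subspace; rewrite -[a *: u]addr0; exact: CD.
Qed.

(** Two elements of [Delta R Z] live over two copies of [Z], pointed by
    different proofs that [Z] is inhabited; this brings the second one over the
    copy of the first, so that both are measures on one measurable space. *)
Lemma reinhabit (q : Delta R Z) (ne : inhabited Z) :
  exists Q : probability (borel ne) R,
    (forall A, Q A = q A) /\ forall u, expect q u = \int[Q]_z u z.
Proof.
case: q => ne' Q Qo; rewrite (Prop_irrelevance ne ne').
by exists Q.
Qed.

Lemma expect_mix_ge0 (a : R) (a01 : 0 < a < 1) (p q : Delta R Z) (u : Z -> R) :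
  Cb u -> (forall z, 0 <= u z) ->
  expect (mix a01 p q) u = a * expect p u + (1 - a) * expect q u.
Proof.
move=> Cu u0; have [Q [Qq ->]] := reinhabit q (Delta_inhabited p).
have /andP[a0 a1] := a01.
pose na := NngNum (ltW a0).
have b0 : 0 <= 1 - a by rewrite subr_ge0 ltW.
pose nb := NngNum b0.
have mu : measurable_fun [set: borel (Delta_inhabited p)] (EFin \o u).
  by have [cu _] := Cu; apply/measurable_EFinP; apply: continuous_borel.
have u0' z : setT z -> (0 <= (EFin \o u) z)%E by rewrite lee_fin.
have iP := integrable_fin_num measurableT (Cb_integrable (Delta_prob p) Cu).
have iQ := integrable_fin_num measurableT (Cb_integrable Q Cu).
rewrite /expect /Rintegral.
transitivity (fine (\int[measure_add (mscale na (Delta_prob p)) (mscale nb Q)]_z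
   (EFin \o u) z)%E).
  congr fine; apply: eq_measure_integral => A mA _ /=.
  etransitivity; last exact: (esym (measure_addE _ _ A)).
  by rewrite /mscale/= /mix_fun -(Qq A).
have -> := @ge0_integral_measure_add _ _ _ (mscale na (Delta_prob p))
  (mscale nb Q) setT measurableT (EFin \o u) u0' mu.
rewrite !ge0_integral_mscale//=.
by rewrite fineD ?fineM// fin_numM.
Qed.

(** The nonnegative case extends by adding a constant to [u]. *)
Lemma expect_mix (a : R) (a01 : 0 < a < 1) (p q : Delta R Z) (u : Z -> R) :
  Cb u ->
  expect (mix a01 p q) u = a * expect p u + (1 - a) * expect q u.
Proof.
move=> Cu; have [cu [M [Mr bu]]] := Cu.
pose k : Z -> R := cst (`|M| + 1).
have k0 z : 0 <= k z by rewrite addr_ge0.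
have Ck : Cb k.
  split; first by move=> x; exact: cst_continuous.
  by exists (`|M| + 1); split => // K hK x _ /=; rewrite ger0_norm ?addr_ge0// ltW.
(* The factor 1 gives [w] the shape to which [expect_linear] applies. *)
pose w : Z -> R := 1 *: u + k.
have [_ CD] := Cb_subspace.
have Cw : Cb w by exact: CD.
have w0 z : 0 <= w z.
  rewrite /w/= /GRing.scale/=.
  have : `|u z| <= `|M| + 1 by apply: bu => //; rewrite ltr_pwDr// ler_norm.
  rewrite ler_norml => /andP[h _].
  change (0 <= 1 * u z + (`|M| + 1)); lra.
have E r : expect r u = expect r w - expect r k.
  by rewrite /w expect_linear//; ring.
by rewrite !E !expect_mix_ge0//; ring.
Qed.

End Expectation.

(** * Bounded continuous functions separate Borel probabilities *)

Section Determining.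
Context {R : realType} {Z : metricType R}.

(** Let [h x] be the largest [r <= 1] such that the ball of radius [r] around
    [x] stays in [A]; this is a truncated distance to the complement of [A],
    which remains defined when the complement is empty.  It is 1-Lipschitz, and
    positive exactly on [A], so [1 - (1 - h)^n] tends to the indicator of [A]. *)
Lemma open_approx (A : set Z) : open A ->
  exists u : nat -> Z -> R, [/\ forall n, continuous (u n),
    forall n x, 0 <= u n x <= 1 & forall x, u n x @[n --> \oo] --> (\1_A x : R)].
Proof.
move=> oA.
pose S x : set R := [set r | 0 <= r <= 1 /\ ball x r `<=` A].
have S0 x : S x 0.
  by split; [rewrite lexx ler01|move=> y; rewrite ballEmdist/= ltNge mdist_ge0].
have hS x : has_sup (S x) by split; [exists 0|exists 1 => r [/andP[]]].
pose h x := sup (S x).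
have h01 x : 0 <= h x <= 1.
  rewrite ub_le_sup//=; last by case: (hS x).
  by apply: ge_sup; [exists 0|move=> r [/andP[]]].
have hL x y : h x <= h y + mdist x y.
  apply: ge_sup; first by exists 0.
  move=> r [/andP[r0 r1] rA].
  have [rd|dr] := leP r (mdist x y); first by rewrite (le_trans rd)// lerDr; case/andP: (h01 y).
  rewrite -lerBlDr; apply: ub_le_sup; first by case: (hS y).
  have d0 := mdist_ge0 x y.
  split; first by lra.
  move=> z; rewrite ballEmdist/= => yz; apply: rA; rewrite ballEmdist/=.
  by apply: le_lt_trans (metric_triangle x y z) _; lra.
have hc : continuous h.
  move=> x; apply/cvgrPdist_lt => e e0; near=> y.
  have : ball x e y by near: y; exact: nbhsx_ballx.
  rewrite ballEmdist/= => xy.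
  have h1 := hL x y; have h2 := hL y x; rewrite (metric_sym y x) in h2.
  rewrite ltr_norml; lra.
have hA x : A x -> 0 < h x.
  move=> Ax; have /nbhs_ballP[e /= e0 eA] := open_nbhs_nbhs (conj oA Ax).
  apply: (@lt_le_trans _ _ (Num.min e 1)); first by rewrite lt_min e0/=.
  apply: ub_le_sup; first by case: (hS x).
  split; first by rewrite ge_min lexx orbT andbT le_min ltW//=.
  by move=> y xy; apply: eA; apply: le_ball xy; rewrite ge_min lexx.
have hNA x : ~ A x -> h x = 0.
  move=> Ax; apply/eqP; rewrite eq_le andbC; case/andP: (h01 x) => -> _ /=.
  apply: ge_sup; first by exists 0.
  move=> r [_ rA]; rewrite leNgt; apply/negP => r0; apply: Ax; apply: rA.
  by rewrite ballEmdist/= mdistxx.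
exists (fun n x => 1 - (1 - h x) ^+ n); split.
- move=> n x; apply: (@cvgB _ R^o); first exact: cvg_cst.
  apply: (@continuous_comp _ _ _ (fun y => 1 - h y) (fun r => r ^+ n)).
    by apply: (@cvgB _ R^o); [exact: cvg_cst|exact: hc].
  exact: exprn_continuous.
- move=> n x; have /andP[h0 h1] := h01 x.
  have : 0 <= (1 - h x) ^+ n <= 1.
    by rewrite exprn_ge0 ?subr_ge0// exprn_ile1// ?subr_ge0// gerBl.
  lra.
move=> x; rewrite indicE; have [|] := boolP (x \in A).
  move=> /set_mem Ax; rewrite -[X in _ --> X]subr0.
  apply: (@cvgB _ R^o); first exact: cvg_cst.
  apply: cvg_expr; rewrite ger0_norm ?subr_ge0; last by case/andP: (h01 x).
  by rewrite gtrBl; exact: hA.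
move=> /negP; rewrite inE => Ax; rewrite hNA// subr0.
under eq_fun do rewrite expr1n subrr.
exact: cvg_cst.
Unshelve. all: by end_near. Qed.

Lemma expect_open_cvg (ne : inhabited Z) (P : probability (borel ne) R)
    (A : set Z) (u : nat -> Z -> R) : open A ->
  (forall n, continuous (u n)) -> (forall n x, 0 <= u n x <= 1) ->
  (forall x, u n x @[n --> \oo] --> (\1_A x : R)) ->
  (\int[P]_z (u n z)%:E)%E @[n --> \oo] --> P A.
Proof.
move=> oA cu u01 uA.
have mA : measurable (A : set (borel ne)) by exact: open_borel.
have -> : P A = (\int[P]_z (\1_A z)%:E)%E.
  by rewrite integral_indic// setIT.
apply: (@dominated_cvg _ _ _ P setT _ (fun n z => (u n z)%:E) _ (cst 1%E)) => //.
- by move=> n; apply/measurable_EFinP; exact: continuous_borel.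
- by move=> x _; apply/fine_cvgP; split; [near=> n|exact: uA].
- exact: (finite_measure_integrable_cst P 1).
- move=> n x _; rewrite lee_fin; have /andP[h0 h1] := u01 n x.
  by rewrite ger0_norm.
Unshelve. all: by end_near. Qed.

Lemma Cb_unit (u : Z -> R) : continuous u -> (forall x, 0 <= u x <= 1) -> Cb u.
Proof.
move=> cu u01; split=> //; exists 1; split=> // K K1 x _.
by have /andP[h0 h1] := u01 x; rewrite /= ger0_norm// (le_trans h1)// ltW.
Qed.

(** The approximations of [open_approx] show that [p] and [q] agree on open
    sets, which are stable under intersection and generate the Borel sets. *)
Lemma expect_inj (p q : Delta R Z) :
  (forall u, Cb u -> expect p u = expect q u) -> p = q.
Proof.
move=> pq; apply: Delta_ext => A sA.
have [Q [Qq EQ]] := reinhabit q (Delta_inhabited p).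
have pQ B : open B -> p B = Q B.
  move=> oB; have [u [cu u01 uB]] := open_approx oB.
  have pB := expect_open_cvg (P := Delta_prob p) oB cu u01 uB.
  have QB := expect_open_cvg (P := Q) oB cu u01 uB.
  have : (fun n => (\int[p]_z (u n z)%:E)%E) = (fun n => (\int[Q]_z (u n z)%:E)%E).
    apply/funext => n; have Cu : Cb (u n) by exact: Cb_unit.
    rewrite -(fineK (integrable_fin_num measurableT (Cb_integrable (Delta_prob p) Cu))).
    rewrite -(fineK (integrable_fin_num measurableT (Cb_integrable Q Cu))).
    by congr EFin; have := pq _ Cu; rewrite EQ.
  move=> e; rewrite e in pB.
  exact: (cvg_unique _ pB QB).
rewrite -Qq.
apply: (@g_sigma_algebra_measure_unique _ R (borel (Delta_inhabited p)) (@open Z) _ (fun=> setT)) => //.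
- by move=> B; exact: open_borel.
- by move=> _; exact: openT.
- by apply/seteqP; split=> // x _; exists 0%N.
- by move=> B C; exact: openI.
- by move=> _; rewrite (le_lt_trans (probability_le1 _ _))// ltry.
Qed.

End Determining.

(** * Independent preorders and coverings *)

Definition prefer (R : realType) (Z : topologicalType) (p q : Delta R Z) :
  set (Z -> R) := [set u | Cb u /\ expect p u < expect q u].

(** Condition (a) in the terms of condition (b). *)
Lemma power_preferP (R : realType) (Z : topologicalType)
    (UU : set (set (Z -> R))) (p q : Delta R Z) : UU `<=` power (@Cb R Z) ->
  (forall U, UU U -> exists2 u, U u & expect p u >= expect q u) <->
  power (prefer p q) `&` UU = set0.
Proof.
move=> UUC; split.
  move=> h; rewrite -subset0 => U [sU /h [u /sU [_ lt]]].
  by rewrite leNgt lt.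
move=> e U UU_U; absurd_not => h.
have : (power (prefer p q) `&` UU) U.
  split=> // u Uu; split; first exact: (UUC U UU_U).
  by rewrite ltNge; exact: h.
by rewrite e.
Qed.

Lemma mixC (R : realType) (Z : metricType R) (a b : R)
    (a01 : 0 < a < 1) (b01 : 0 < b < 1) (p q : Delta R Z) :
  a + b = 1 -> mix a01 p q = mix b01 q p.
Proof.
move=> ab; apply: expect_inj => u Cu; rewrite !expect_mix//.
by rewrite (_ : b = 1 - a); [ring|lra].
Qed.

Section IndependentPreorder.
Context {R : realType} {Z : metricType R}.
Variable Rel : set (Delta R Z * Delta R Z).
Hypothesis Rel_refl : forall p, Rel (p, p).
Hypothesis Rel_trans : forall p q r, Rel (p, q) -> Rel (q, r) -> Rel (p, r).
Hypothesis Rel_indep : independence Rel.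

Lemma rel_mix (a : R) (a01 : 0 < a < 1) (p1 q1 p2 q2 : Delta R Z) :
  Rel (p1, q1) -> Rel (p2, q2) -> Rel (mix a01 p1 p2, mix a01 q1 q2).
Proof.
move=> R1 R2; have b01 : 0 < 1 - a < 1 by lra.
apply: (@Rel_trans _ (mix a01 q1 p2)); first exact: (Rel_indep _ _ _ a01).1.
rewrite !(mixC a01 b01) ?subrKC//; exact: (Rel_indep _ _ _ b01).1.
Qed.

(** Independence makes the relation depend only on the direction of [q - p]:
    [q + a p1 = p + a q1] after normalisation is an equality of mixtures, where
    the pair on one side arises from [(p, q)] and on the other from
    [(p1, q1)]. *)
Lemma rel_direction (a : R) (p q p1 q1 : Delta R Z) : 0 <= a -> Rel (p1, q1) ->
  (forall u, Cb u -> expect q u - expect p u = a * (expect q1 u - expect p1 u)) ->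
  Rel (p, q).
Proof.
rewrite le_eqVlt => /orP[/eqP <- _ pq|a0 R1 pq].
  rewrite (_ : q = p)//; apply: expect_inj => u Cu.
  by have := pq u Cu; rewrite mul0r => /eqP; rewrite subr_eq0 => /eqP.
(* [s] normalises the total mass [1 + a] of [q + a p1]. *)
pose s := (1 + a)^-1.
have sa : s * a = 1 - s by rewrite /s; field; lra.
have s0 : 0 < s by rewrite invr_gt0; lra.
have sa0 : 0 < s * a by rewrite mulr_gt0.
have s01 : 0 < s < 1 by lra.
have t01 : 0 < s * a < 1 by lra.
apply: (Rel_indep _ _ p1 s01).2.
have -> : mix s01 p p1 = mix t01 p1 p by apply: mixC; lra.
have -> : mix s01 q p1 = mix t01 q1 p.
  apply: expect_inj => u Cu; rewrite !expect_mix// sa.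
  have := congr1 (fun x => s * x) (pq u Cu); rewrite /= mulrA sa; lra.
exact: (Rel_indep _ _ _ t01).1.
Qed.

(** If both coefficients given by [farkas2] are positive, the directions
    [q1 - p1] and [q2 - p2] are first averaged in the ratio [a : b]. *)
Lemma rel_cover (p q p1 q1 p2 q2 : Delta R Z) :
  prefer p q `<=` prefer p1 q1 `|` prefer p2 q2 ->
  Rel (p1, q1) -> Rel (p2, q2) -> Rel (p, q).
Proof.
move=> cover R1 R2.
have lin p' q' : linear_on (@Cb R Z) (fun u => expect q' u - expect p' u).
  by move=> a u v Cu Cv; rewrite !expect_linear//; ring.
have [a [b [a0 b0 pq]]] : exists a b, [/\ 0 <= a, 0 <= b & forall u, Cb u ->
    expect q u - expect p u =
    a * (expect q1 u - expect p1 u) + b * (expect q2 u - expect p2 u)].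
  apply: (farkas2 Cb_subspace (lin p q) (lin p1 q1) (lin p2 q2)) => u Cu.
  rewrite !subr_le0 => le1 le2; rewrite leNgt; apply/negP => lt.
  by have [[_]|[_]] := cover u (conj Cu lt); rewrite ltNge ?le1 ?le2.
have [a00|an0] := eqVneq a 0.
  by apply: (rel_direction b0 R2) => u Cu; rewrite pq// a00 mul0r add0r.
have [b00|bn0] := eqVneq b 0.
  by apply: (rel_direction a0 R1) => u Cu; rewrite pq// b00 mul0r addr0.
have {an0 a0} a0 : 0 < a by rewrite lt_neqAle eq_sym an0.
have {bn0 b0} b0 : 0 < b by rewrite lt_neqAle eq_sym bn0.
have ab : 0 < a + b by rewrite addr_gt0.
have t01 : 0 < a / (a + b) < 1.
  by rewrite divr_gt0//= ltr_pdivrMr// mul1r ltrDl.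
apply: (rel_direction (ltW ab) (rel_mix t01 R1 R2)) => u Cu.
by rewrite !expect_mix// pq//; field; rewrite gt_eqF.
Qed.

End IndependentPreorder.

Theorem corollary4p3 (R : realType) (Z : metricType R) (sepZ : separable_space Z)
    (Rel : set (Delta R Z * Delta R Z)) :
  [/\ (forall p, Rel (p, p)),
      (forall p q r, Rel (p, q) -> Rel (q, r) -> Rel (p, r)) &
      independence Rel]
  <->
  exists UU : set (set (Z -> R)),
    [/\ UU !=set0,
        UU `<=` power (@Cb R Z),
        (forall U, UU U -> U !=set0),
        (forall p q, Rel (p, q) <->
           forall U, UU U -> exists2 u, U u & expect p u >= expect q u) &
        (forall U1 U2 V, @scrU0 R Z U1 -> @scrU0 R Z U2 -> @scrU0 R Z V ->
           V `<=` U1 `|` U2 ->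
           power U1 `&` UU = set0 -> power U2 `&` UU = set0 ->
           power V `&` UU = set0)].
Proof.
split.
  move=> [Rrefl Rtrans Rind].
  (* [Cb] itself keeps the family nonempty when the relation is total; it is
     contained in no [prefer p q], since it contains 0. *)
  pose UU : set (set (Z -> R)) :=
    [set U | U = @Cb R Z \/ exists p q, ~ Rel (p, q) /\ U = prefer p q].
  have UUC : UU `<=` power (@Cb R Z).
    by move=> U [->|[p [q [_ ->]]]] u //= [].
  have C0 : Cb (0 : Z -> R) by case: (@Cb_subspace R Z).
  have UUE p q : Rel (p, q) <->
      forall U, UU U -> exists2 u, U u & expect p u >= expect q u.
    split=> [Rpq U [->|[p' [q' [nR ->]]]]|h].
    - exists 0 => //.
      by rewrite !(linear_on0 Cb_subspace (expect_linear _)).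
    - absurd_not => h; apply: nR.
      apply: (rel_cover Rrefl Rtrans Rind _ Rpq Rpq) => u pu; left.
      split; first by case: pu.
      by rewrite ltNge; exact: h.
    - absurd_not => nR.
      have [|u [_ lt]] := h (prefer p q); first by right; exists p, q.
      by rewrite leNgt lt.
  exists UU; split=> //.
  - by exists (@Cb R Z); left.
  - move=> U [->|[p [q [nR ->]]]]; first by exists 0.
    (* If neither [u] nor [- u] lies in [prefer p q], then [p] and [q] give [u] the
       same expectation; equal measures are related by reflexivity. *)
    apply: contrapT => h; apply: nR.
    rewrite (_ : q = p)//; apply: expect_inj => u Cu.
    have [CN EN] : Cb (-1 *: u) /\ forall r, expect r (-1 *: u) = - expect r u.
      split=> [|r]; first by have [] := linear_onZ Cb_subspace (expect_linear p) (-1) Cu.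
      have [_ ->] := linear_onZ Cb_subspace (expect_linear r) (-1) Cu.
      by rewrite mulN1r.
    apply/eqP; rewrite eq_le !leNgt; apply/andP; split; apply/negP => lt.
      by apply: h; exists u.
    by apply: h; exists (-1 *: u); split=> //; rewrite !EN ltrN2.
  - move=> _ _ _ [p1 [q1 ->]] [p2 [q2 ->]] [p [q ->]] cover.
    have E p' q' := iff_trans (UUE p' q') (power_preferP p' q' UUC).
    move=> /E R1 /E R2; apply/E.
    exact: (rel_cover Rrefl Rtrans Rind cover R1 R2).
move=> [UU [_ UUC UUn0 UUE UUb]].
have E p q := iff_trans (UUE p q) (power_preferP p q UUC).
have S0 p q : scrU0 (prefer p q : set (Z -> R)) by exists p, q.
split.
- move=> p; apply/UUE => U /UUn0[u Uu]; by exists u.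
- move=> p q r /E pq /E qr; apply/E.
  apply: (UUb _ _ _ (S0 p q) (S0 q r) (S0 p r) _ pq qr) => u [Cu pr].
  have [lt|le] := ltP (expect p u) (expect q u); first by left.
  by right; split=> //; exact: le_lt_trans pr.
move=> p q r a a01; apply: iff_trans (E p q) (iff_trans _ (iff_sym (E _ _))).
have lt_mix u : Cb u ->
    (expect (mix a01 p r) u < expect (mix a01 q r) u) = (expect p u < expect q u).
  by move=> Cu; rewrite !expect_mix// ltrD2r ltr_pM2l//; case/andP: a01.
rewrite (_ : prefer (mix a01 p r) (mix a01 q r) = prefer p q)//.
by apply/seteqP; split=> u [Cu lt]; split=> //; move: lt; rewrite lt_mix.
Qed.
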